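(* Let $p \in \{1,2\}$ and let $M$ be a pointwise finite dimensional persistence module over $(\mathbb{R},\leq)$ all of whose barcode intervals are finite (bounded). Then there exists a constant $C_{M,p} > 0$ (depending only on $M$ and $p$) such that for every pointwise finite dimensional persistence module $N$ over $(\mathbb{R},\leq)$ satisfying $$W_1(\mathrm{Dgm}(M), \mathrm{Dgm}(N)) \leq 1,$$ we have $$\left\| \beta^M - \beta^N \right\|_p \leq C_{M,p} \cdot W_1(\mathrm{Dgm}(M), \mathrm{Dgm}(N))^{1/p}.$$
   Context: Persistence modules. Fix a field $\mathbb{F}$. A pointwise finite dimensional (p.f.d.) persistence module is a functor $M$ from the poset category $(\mathbb{R},\leq)$ to finite dimensional $\mathbb{F}$-vector spaces. For $b<d$ (with $d$ possibly $+\infty$), the interval module $\mathbb{I}[b,d)$ equals $\mathbb{F}$ at every $x$ with $b \leq x < d$ and $0$ elsewhere, with identity maps between the nonzero copies of $\mathbb{F}$. Standing convention: every persistence module considered is isomorphic to a finite direct sum of interval modules $\mathbb{I}[b_1,d_1) \oplus \cdots \oplus \mathbb{I}[b_m,d_m)$, unique up to reordering; the multiset of intervals $[b_i,d_i)$ is its barcode. Rank functions. Let $\mathbb{R}^{2+} = \{(x,y) \in (\{-\infty\}\cup\mathbb{R}) \times (\mathbb{R}\cup\{\infty\}) : x \leq y\}$. The rank function of $M$ is $\beta^M : \mathbb{R}^{2+} \to \mathbb{Z}$, $\beta^M(x,y) = \operatorname{rank} M(x \leq y)$. (Points with an infinite coordinate play no role for the integrals below.) Norm. $\|f\|_p = \left(\int_{\mathbb{R}^{2+}}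 |f|^p \, d\omega\right)^{1/p}$, where $\omega$ is two-dimensional Lebesgue measure. Persistence diagrams and 1-Wasserstein distance. $\mathrm{Dgm}(M)$ is the multiset consisting of the points $(b_i,d_i)$ for the intervals $[b_i,d_i)$ in the barcode of $M$ (with multiplicity), together with every point of the diagonal $\{(x,x)\}$ counted with infinite multiplicity. The 1-Wasserstein distance is $$W_1(D_1,D_2) = \inf_{\phi} \sum_{x\in D_1} \|x-\phi(x)\|_1,$$ where $\phi$ ranges over all bijections of multisets $D_1\to D_2$ and $\|\cdot\|_1$ is the $\ell^1$ norm on $\mathbb{R}^2$. *)

(* Defs.v *)
From HB Require Import structures.
From mathcomp Require Import all_boot all_order all_algebra.
From mathcomp Require Import all_classical all_reals all_analysis.

Set Implicit Arguments.
Unset Strict Implicit.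
Unset Printing Implicit Defensive.

Import Order.TTheory GRing.Theory Num.Theory.
Import numFieldNormedType.Exports.

Local Open Scope classical_set_scope.
Local Open Scope ring_scope.

(* [vectType F] is the type of finite dimensional F-vector spaces, so this is
   a functor from the poset (R, <=) to such spaces. *)
Record pmodule (R : realType) (F : fieldType) := PModule {
  pm_space :> R -> vectType F ;
  pm_map : forall x y : R, x <= y -> 'Hom(pm_space x, pm_space y) ;
  pm_map_id : forall (x : R) (lexx : x <= x), pm_map lexx = \1%VF ;
  pm_map_comp : forall (x y z : R) (lexy : x <= y) (leyz : y <= z)
      (lexz : x <= z), (pm_map leyz \o pm_map lexy)%VF = pm_map lexz }.

Definition pm_iso (R : realType) (F : fieldType) (M N : pmodule R F) : Prop :=
  exists (f : forall x, 'Hom(M x, N x)) (g : forall x, 'Hom(N x, M x)),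
    (forall x, (g x \o f x)%VF = \1%VF /\ (f x \o g x)%VF = \1%VF) /\
    (forall (x y : R) (lexy : x <= y),
       (f y \o pm_map M lexy)%VF = (pm_map N lexy \o f x)%VF).

Definition in_bar (R : realType) (I : R * \bar R) (x : R) : bool :=
  (I.1 <= x) && (x%:E < I.2)%E.

Section IntervalModule.
Variables (R : realType) (F : fieldType) (I : R * \bar R).

(* The boolean [in_bar I x] is read as a dimension, 0 or 1. *)
Definition interval_space (x : R) : vectType F := 'rV[F]_(in_bar I x).

(* [pid_mx 1] is the identity of F when both endpoints lie in I, and the zero
   (empty) matrix otherwise. *)
Definition interval_map (x y : R) (_ : x <= y) :
    'Hom(interval_space x, interval_space y) :=
  linfun (mulmxr (pid_mx 1 : 'M[F]_(in_bar I x, in_bar I y))).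

Lemma interval_map_id (x : R) (lexx : x <= x) : interval_map lexx = \1%VF.
Proof.
apply/lfunP => v; rewrite lfunE id_lfunE /=.
rewrite (_ : pid_mx 1 = 1%:M) ?mulmx1 //.
apply/matrixP => i j; rewrite !mxE.
have -> : (i < 1)%N by rewrite (leq_trans (ltn_ord i)) // leq_b1.
by rewrite andbT.
Qed.

Lemma interval_map_comp (x y z : R) (lexy : x <= y) (leyz : y <= z)
    (lexz : x <= z) :
  (interval_map leyz \o interval_map lexy)%VF = interval_map lexz.
Proof.
apply/lfunP => v; rewrite comp_lfunE !lfunE /= -mulmxA; congr (_ *m _).
have [yI|yI] := boolP (in_bar I y).
  by rewrite pid_mx_id.
rewrite mul_pid_mx min0n pid_mx_0; apply/matrixP => i j; exfalso.
have ord_pos (b : bool) (k : 'I_b) : b by case: b k => // -[].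
have /andP[Ix _] := ord_pos _ i; have /andP[_ zI] := ord_pos _ j.
move/negP: yI; apply; rewrite /in_bar (le_trans Ix lexy) /=.
by rewrite (le_lt_trans _ zI) // lee_fin.
Qed.

Definition interval_module : pmodule R F :=
  PModule interval_map_id interval_map_comp.

End IntervalModule.

Section DirectSum.
Variables (R : realType) (F : fieldType).

Definition lfun_prod (U1 U2 V1 V2 : vectType F)
    (f : 'Hom(U1, V1)) (g : 'Hom(U2, V2)) : U1 * U2 -> V1 * V2 :=
  fun u => (f u.1, g u.2).

Lemma lfun_prod_linear (U1 U2 V1 V2 : vectType F)
    (f : 'Hom(U1, V1)) (g : 'Hom(U2, V2)) : linear (lfun_prod f g).
Proof. by move=> a u v; rewrite /lfun_prod /= !linearP. Qed.

HB.instance Definition _ (U1 U2 V1 V2 : vectType F)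
    (f : 'Hom(U1, V1)) (g : 'Hom(U2, V2)) :=
  GRing.isLinear.Build F (U1 * U2)%type (V1 * V2)%type *:%R (lfun_prod f g)
    (lfun_prod_linear f g).

Variables M N : pmodule R F.

Definition dsum_space (x : R) : vectType F := (M x * N x)%type.

Definition dsum_map (x y : R) (lexy : x <= y) :
    'Hom(dsum_space x, dsum_space y) :=
  linfun (lfun_prod (pm_map M lexy) (pm_map N lexy)).

Lemma dsum_map_id (x : R) (lexx : x <= x) : dsum_map lexx = \1%VF.
Proof.
apply/lfunP => -[u v]; rewrite lfunE id_lfunE /= /lfun_prod /=.
by rewrite !pm_map_id !id_lfunE.
Qed.

Lemma dsum_map_comp (x y z : R) (lexy : x <= y) (leyz : y <= z)
    (lexz : x <= z) : (dsum_map leyz \o dsum_map lexy)%VF = dsum_map lexz.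
Proof.
apply/lfunP => -[u v]; rewrite comp_lfunE !lfunE /= /lfun_prod /=.
by rewrite -!(pm_map_comp _ lexy leyz lexz) !comp_lfunE.
Qed.

Definition dsum : pmodule R F := PModule dsum_map_id dsum_map_comp.

End DirectSum.

Section ZeroModule.
Variables (R : realType) (F : fieldType).

Definition zero_space (x : R) : vectType F := 'rV[F]_0.

Definition zero_map (x y : R) (_ : x <= y) :
  'Hom(zero_space x, zero_space y) := \1%VF.

Lemma zero_map_id (x : R) (lexx : x <= x) : zero_map lexx = \1%VF.
Proof. by []. Qed.

Lemma zero_map_comp (x y z : R) (lexy : x <= y) (leyz : y <= z)
    (lexz : x <= z) : (zero_map leyz \o zero_map lexy)%VF = zero_map lexz.
Proof. by rewrite /zero_map comp_lfun1l. Qed.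

Definition zero_module : pmodule R F := PModule zero_map_id zero_map_comp.

End ZeroModule.

Definition interval_sum (R : realType) (F : fieldType)
    (bs : seq (R * \bar R)) : pmodule R F :=
  foldr (fun I => dsum (interval_module F I)) (zero_module R F) bs.

Definition is_barcode (R : realType) (F : fieldType) (M : pmodule R F)
    (bs : seq (R * \bar R)) : Prop :=
  all (fun I => (I.1%:E < I.2)%E) bs /\ pm_iso M (interval_sum F bs).

Definition interval_decomposable (R : realType) (F : fieldType)
  (M : pmodule R F) : Prop := exists bs, is_barcode M bs.

(* A listing of the barcode. The listing order is a choice, but barcodes are
   unique up to reordering and nothing below depends on the order.  The value
   is irrelevant when M is not interval decomposable. *)
Definition barcode (R : realType) (F : fieldType) (M : pmodule R F) :
  seq (R * \bar R) := xget [::] [set bs | is_barcode M bs].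

(* Points with an infinite coordinate are left out: they form a null set. *)
Definition R2plus (R : realType) : set (R * R) := [set z | z.1 <= z.2].

(* The rank function, extended by 0 outside R2plus. *)
Definition rank_fun (R : realType) (F : fieldType) (M : pmodule R F)
    (z : R * R) : int :=
  match @idP (z.1 <= z.2) with
  | ReflectT le_z => (\dim (limg (pm_map M le_z)))%:Z
  | ReflectF _ => 0
  end.

Definition normp (R : realType) (p : R) (f : R * R -> R) : \bar R :=
  ('N[(@lebesgue_measure R \x @lebesgue_measure R)%E]_(p%:E)
     [(EFin \o f) \_ (@R2plus R)])%E.

(* A multiset of points, given as a family: a point occurs as many times as it
   has indices. *)
Record diagram (R : realType) := Diagram {
  dgm_index : choiceType ;
  dgm_point : dgm_index -> R * \bar R }.

(* The summand R * nat lists each diagonal point (x, x) countably many times. *)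
Definition dgm_of_bars (R : realType) (bs : seq (R * \bar R)) : diagram R :=
  @Diagram R ('I_(size bs) + R * nat)%type (fun i =>
    match i with
    | inl k => tnth (in_tuple bs) k
    | inr (x, _) => (x, x%:E)
    end).

Definition Dgm (R : realType) (F : fieldType) (M : pmodule R F) : diagram R :=
  dgm_of_bars (barcode M).

(* The test [u.2 == v.2] makes two infinite deaths be at distance 0 (here
   [+oo - +oo = -oo]); a finite and an infinite death are at distance +oo. *)
Definition dist1 (R : realType) (u v : R * \bar R) : \bar R :=
  (`|u.1 - v.1|%:E + (if u.2 == v.2 then 0 else `|u.2 - v.2|))%E.

Definition W1 (R : realType) (D1 D2 : diagram R) : \bar R :=
  ereal_inf [set c | exists phi : dgm_index D1 -> dgm_index D2,
    bijective phi /\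
    c = \esum_(i in setT) dist1 (dgm_point i) (dgm_point (phi i))].

(* Main.v *)
(* A bijection between the diagrams pairs the bars of M and N, a bar possibly
   being paired with a diagonal point, and the difference of the rank functions
   is the sum over these pairs of the differences of the indicator functions of
   the triangles {b <= x <= y < d}.  If a pair has cost c and its first bar has
   length l, the two triangles differ on a set of area at most c (l + c), so
   Minkowski's inequality bounds the L^p norm by the sum of (c (l + c))^(1/p).
   Each of the finitely many bars of M contributes O(c^(1/p)); the number of
   bars of N paired with diagonal points is not bounded in terms of M, but there
   l = 0 and c^(2/p) = O(c) because p <= 2, so these terms are summable. *)
From HB Require Import structures.
Require Import Defs.
From mathcomp Require Import all_boot all_order all_algebra.
From mathcomp Require Import all_classical all_reals all_analysis.
From mathcomp Require Import measurable_realfun lra.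
Import Order.TTheory GRing.Theory Num.Theory.
Local Open Scope ring_scope.

(** * Linear algebra: the rank of a direct sum of maps *)

Lemma lker0_dim_limg (F : fieldType) (U V : vectType F) (f : 'Hom(U, V))
    (W : {vspace U}) : lker f == 0%VS -> \dim (f @: W) = \dim W.
Proof. by move=> /eqP kf; rewrite limg_dim_eq // kf capv0. Qed.

(** The two coordinate injections [l] and [r] carry [limg f] and [limg g] onto complementary parts
    of the image: they are injective, so dimensions are kept, and their ranges meet only in 0. *)
Lemma dim_limg_lfun_prod (F : fieldType) (U1 U2 V1 V2 : vectType F)
    (f : 'Hom(U1, V1)) (g : 'Hom(U2, V2)) :
  \dim (limg (linfun (lfun_prod f g))) = (\dim (limg f) + \dim (limg g))%N.
Proof.
have linl : linear (fun v : V1 => (v, 0 : V2)).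
  by move=> a u v; apply: injective_projections; rewrite /= ?scaler0 ?addr0.
have linr : linear (fun v : V2 => (0 : V1, v)).
  by move=> a u v; apply: injective_projections; rewrite /= ?scaler0 ?addr0.
pose cl := GRing.isLinear.Build _ _ _ _ _ linl.
pose cr := GRing.isLinear.Build _ _ _ _ _ linr.
pose l : {linear V1 -> (V1 * V2)%type} :=
  HB.pack (fun v : V1 => (v, 0 : V2)) cl.
pose r : {linear V2 -> (V1 * V2)%type} :=
  HB.pack (fun v : V2 => (0 : V1, v)) cr.
have kl : lker (linfun l) == 0%VS.
  by apply/lker0P => u v; rewrite !lfunE => -[].
have kr : lker (linfun r) == 0%VS.
  by apply/lker0P => u v; rewrite !lfunE => -[].
have -> : limg (linfun (lfun_prod f g)) =
    (linfun l @: limg f + linfun r @: limg g)%VS.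
  apply/vspaceP => w; apply/memv_imgP/memv_addP.
    move=> [[u v] _ ->]; rewrite lfunE /=.
    exists (linfun l (f u)); first by rewrite !memv_img ?memvf.
    exists (linfun r (g v)); first by rewrite !memv_img ?memvf.
    by rewrite !lfunE /= /lfun_prod /=; congr (_, _); rewrite ?addr0 ?add0r.
  move=> [_ /memv_imgP[_ /memv_imgP[u _ ->] ->]].
  move=> [_ /memv_imgP[_ /memv_imgP[v _ ->] ->] ->].
  exists (u, v); first exact: memvf.
  by rewrite !lfunE /= /lfun_prod /=; congr (_, _); rewrite ?addr0 ?add0r.
rewrite dimv_disjoint_sum.
  by rewrite (lker0_dim_limg _ _ _ _ _ kl) (lker0_dim_limg _ _ _ _ _ kr).
apply/eqP; rewrite -subv0; apply/subvP => w.
rewrite memv_cap => /andP[/memv_imgP[u _ ->] /memv_imgP[v _]].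
by rewrite !lfunE /= => -[-> _]; rewrite memv0.
Qed.

(** * Rank functions as sums of indicators of triangles *)

Definition in_tri {R : realType} (I : R * \bar R) (z : R * R) : bool :=
  [&& I.1 <= z.1, z.1 <= z.2 & (z.2%:E < I.2)%E].

Section Rank.
Variables (R : realType) (F : fieldType).
Implicit Types (M N : pmodule R F) (I : R * \bar R).

(** [rank_fun] feeds [pm_map] the proof found by matching on [idP]; proof irrelevance exchanges it
    for any given one. *)
Lemma rank_funE M (z : R * R) (le_z : z.1 <= z.2) :
  rank_fun M z = (\dim (limg (pm_map M le_z)))%:Z.
Proof.
rewrite /rank_fun; case: {-}_ / idP => // h; do 4 f_equal.
exact: Prop_irrelevance.
Qed.

(** In the naturality square, the injective [f z.2] on the left keeps the dimension of the image,
    and the surjective [f z.1] on the right keeps the image itself. *)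
Lemma rank_fun_iso M N : pm_iso M N -> rank_fun M =1 rank_fun N.
Proof.
move=> [f [g [fgK fM]]] z; have [le_z|gt_z] := boolP (z.1 <= z.2); last first.
  by rewrite /rank_fun; case: {-}_ / idP => // h; rewrite h in gt_z.
rewrite !rank_funE; congr Posz.
have kf : lker (f z.2) == 0%VS.
  apply/lker0P => u v /(congr1 (g z.2)).
  by rewrite -!comp_lfunE (fgK _).1 !id_lfunE.
have limf : limg (f z.1) = fullv.
  apply/vspaceP => v; rewrite memvf; apply/memv_imgP.
  by exists (g z.1 v); rewrite ?memvf // -comp_lfunE (fgK _).2 id_lfunE.
have := congr1 (fun h => \dim (limg h)) (fM _ _ le_z).
by rewrite /= !limg_comp limf lker0_dim_limg.
Qed.

Lemma rank_fun_dsum M N z :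
  rank_fun (dsum M N) z = rank_fun M z + rank_fun N z.
Proof.
have [le_z|gt_z] := boolP (z.1 <= z.2); last first.
  by rewrite /rank_fun; case: {-}_ / idP => // h; rewrite h in gt_z.
by rewrite !rank_funE /= dim_limg_lfun_prod.
Qed.

Lemma rank_fun_interval I z :
  rank_fun (interval_module F I) z = (in_tri I z)%:Z.
Proof.
rewrite /in_tri; have [le_z|gt_z] := boolP (z.1 <= z.2); last first.
  rewrite andbF /rank_fun; case: {-}_ / idP => // h; by rewrite h in gt_z.
rewrite rank_funE /= /interval_map.
(* By convexity of the bar, the condition says that both spaces are one-dimensional; if it fails,
   one of them is zero and so is the map. *)
have -> : (I.1 <= z.1) && (z.2%:E < I.2)%E = in_bar I z.1 && in_bar I z.2.
  rewrite /in_bar; apply/andP/andP => [[Iz zI]|[/andP[Iz _] /andP[_ zI]]] //.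
  by rewrite Iz zI (le_trans Iz le_z) (le_lt_trans _ zI) ?lee_fin.
congr Posz; rewrite /interval_space.
case: (in_bar I z.1) (in_bar I z.2) => [] []; last 3 first.
- apply/eqP; rewrite dimv_eq0 -subv0; apply/subvP => _ /memv_imgP[v _ ->].
  by rewrite memv0 lfunE /=; apply/eqP/matrixP => i [].
- apply/eqP; rewrite dimv_eq0 -subv0; apply/subvP => _ /memv_imgP[v _ ->].
  by rewrite memv0 (thinmx0 v) linear0.
- apply/eqP; rewrite dimv_eq0 -subv0; apply/subvP => _ /memv_imgP[v _ ->].
  by rewrite memv0 (thinmx0 v) linear0.
rewrite (_ : limg _ = fullv) ?dimvf ?dim_matrix //.
apply/vspaceP => v; rewrite memvf; apply/memv_imgP.
exists v; first exact: memvf.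
by rewrite lfunE /= pid_mx_1 mulmx1.
Qed.

Lemma rank_fun_interval_sum (bs : seq (R * \bar R)) z :
  rank_fun (interval_sum F bs) z = \sum_(I <- bs) (in_tri I z)%:Z.
Proof.
elim: bs => [|I bs IH]; last first.
  by rewrite big_cons /= rank_fun_dsum rank_fun_interval IH.
rewrite big_nil /rank_fun; case: {-}_ / idP => // le_z; congr Posz.
apply/eqP; rewrite dimv_eq0 -subv0; apply/subvP => w _.
by rewrite memv0 (thinmx0 w).
Qed.

Lemma barcodeP M : interval_decomposable M -> is_barcode M (barcode M).
Proof.
by move=> hM; apply: (@xgetPex _ [::] [set bs | is_barcode M bs]%classic).
Qed.

Lemma rank_fun_barcode M z : interval_decomposable M ->
  rank_fun M z = \sum_(I <- barcode M) (in_tri I z)%:Z.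
Proof.
move=> /barcodeP[_ iso].
by rewrite (rank_fun_iso _ _ iso) rank_fun_interval_sum.
Qed.
End Rank.

(** * Finite sums over diagram indices, and Minkowski's inequality *)

Lemma big_sum_type_inl (V : nmodType) (m : nat) (X : eqType)
    (t : seq ('I_m + X)) (h : 'I_m + X -> V) :
  uniq t -> (forall i, inl i \in t) -> (forall x, h (inr x) = 0) ->
  \sum_(k <- t) h k = \sum_(i < m) h (inl i).
Proof.
move=> ut it h0; pose is_l (k : 'I_m + X) := if k is inl _ then true else false.
rewrite (bigID is_l) /= [X in _ + X]big1 ?addr0; last by case.
rewrite -big_filter -(big_map (@inl _ X) predT h); apply: perm_big.
apply: uniq_perm; first by rewrite filter_uniq.
  by rewrite map_inj_uniq ?index_enum_uniq // => i j [].
case=> [i|x]; rewrite mem_filter /= ?it; apply/esym; last by apply/mapP => -[].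
by rewrite mem_map ?mem_index_enum // => i' j [].
Qed.

Lemma Lnorm_sum_le d (T : measurableType d) (R : realType)
    (mu : {measure set T -> \bar R}) (p : R) (I : Type) (s : seq I)
    (f : I -> T -> R) :
  1 <= p -> (forall i, measurable_fun setT (f i)) ->
  ('N[mu]_p%:E[EFin \o (fun z => (\sum_(i <- s) f i z)%R)] <=
   \sum_(i <- s) 'N[mu]_p%:E[EFin \o f i])%E.
Proof.
move=> p1 mf; elim: s => [|i s IH].
  rewrite big_nil (_ : EFin \o _ = cst 0%E) ?Lnorm0 //.
    by rewrite eqe gt_eqF // (lt_le_trans ltr01).
  by apply/funext => z /=; rewrite big_nil.
rewrite big_cons (_ : (fun z => _) = (f i \+ (fun z => \sum_(j <- s) f j z))%R).
  apply: (le_trans (minkowski_EFin _ _ _ _)) => //; last exact: leeD2l.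
  exact: measurable_sum.
by apply/funext => z /=; rewrite big_cons.
Qed.

(** * Areas and L^p norms for triangles *)

Definition tri {R : realType} (I : R * \bar R) (z : R * R) : R :=
  (in_tri I z)%:R.

Section Triangles.
Local Open Scope classical_set_scope.
Variable R : realType.
Implicit Types (I J : R * \bar R) (b d c : R).

Let mu := (@lebesgue_measure R \x @lebesgue_measure R)%E.

Lemma measurable_in_tri I : measurable [set z | in_tri I z].
Proof.
rewrite (_ : [set z | _] = [set: R * R] `&` [set z | I.1 <= z.1]
    `&` [set z | z.1 <= z.2] `&` [set z | (z.2%:E < I.2)%E]).
  apply: measurable_lte; last 2 first.
  - by apply: measurable_funTS; apply/measurable_EFinP; exact: measurable_snd.
  - exact: measurable_cst.
  apply: measurable_fun_le.
  - by apply: measurable_fun_le => //; exact: measurable_fst.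
  - by apply: measurable_funTS; exact: measurable_fst.
  - by apply: measurable_funTS; exact: measurable_snd.
apply/seteqP; split => z /=; first by move=> /and3P[].
by move=> [[[_ ? ?] ?]]; apply/and3P.
Qed.

Lemma measurable_tri_symdiff I J :
  measurable [set z | in_tri I z != in_tri J z].
Proof.
rewrite (_ : [set z | _] = [set z | in_tri I z] `+` [set z | in_tri J z]).
  by apply: measurableU; apply: measurableD; exact: measurable_in_tri.
apply/seteqP; split => z /=.
  by case: in_tri; case: in_tri => //; [left|right].
by move=> [[->]|[->]] /negP/negbTE ->.
Qed.

Lemma tri_indic I : tri I = \1_[set z | in_tri I z].
Proof. by apply/funext => z; rewrite indicE mem_setE. Qed.

Lemma measurable_tri I : measurable_fun setT (tri I).
Proof.
by rewrite tri_indic; apply: measurable_indic; exact: measurable_in_tri.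
Qed.

Lemma tri_diag (x : R) : tri (x, x%:E) = cst 0.
Proof.
apply/funext => z; rewrite /tri /in_tri /= lte_fin; apply/eqP.
rewrite pnatr_eq0 eqb0; apply/negP => /and3P[xz zz zx].
by have := le_lt_trans (le_trans xz zz) zx; rewrite ltxx.
Qed.

Lemma lebesgue_rectangle (a b c d : R) : a <= b -> c <= d ->
  mu (`[a, b] `*` `[c, d]) = ((b - a) * (d - c))%:E.
Proof.
have itvE (x y : R) : x <= y -> lebesgue_measure `[x, y] = (y - x)%:E.
  rewrite lebesgue_measure_itv /= lte_fin le_eqVlt => /predU1P[->|->] //.
  by rewrite ltxx subrr.
move=> ab cd; rewrite [mu _]product_measure1E // EFinM.
by congr (_ * _)%E; exact: itvE.
Qed.

(** A point in exactly one triangle has its first coordinate between the two births or its second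
    between the two deaths. So it lies in a vertical strip [B1] of width [|b - b'|] or a horizontal
    strip [B2] of height [|d - d'|], both of length [hi - lo]. *)
Lemma area_tri_symdiff b d b' d' (c := `|b - b'| + `|d - d'|) : b <= d ->
  (mu [set z | in_tri (b, d%:E) z != in_tri (b', d'%:E) z]
     <= (c * (d - b + c))%:E)%E.
Proof.
move=> bd; pose lo := Num.min b b'; pose hi := Num.max d d'.
have loN : lo <= Num.max b b' by rewrite le_max ge_min lexx.
have hiN : Num.min d d' <= hi by rewrite le_max ge_min lexx.
have lohi : lo <= hi by rewrite ge_min le_max bd.
set B1 := `[lo, Num.max b b'] `*` `[lo, hi].
set B2 := `[lo, hi] `*` `[Num.min d d', hi].
have mB1 : measurable B1 by exact: measurableX.
have mB2 : measurable B2 by exact: measurableX.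
apply: (@le_trans _ _ (mu (B1 `|` B2))).
  apply: le_measure; rewrite ?inE.
  - exact: measurable_tri_symdiff.
  - exact: measurableU.
  move=> z /=; rewrite /B1 /B2 /in_tri /= !in_itv /= !lte_fin => neqz.
  have [z12 bz zd] : [/\ z.1 <= z.2, lo <= z.1 & z.2 <= hi].
    have : [&& b <= z.1, z.1 <= z.2 & z.2 < d]
        || [&& b' <= z.1, z.1 <= z.2 & z.2 < d'].
      by case: [&& b <= _, _ & _] neqz; case: [&& b' <= _, _ & _].
    rewrite ge_min le_max => /orP[] /and3P[bz z12 /ltW zd];
      by rewrite bz z12 zd ?orbT.
  (* Otherwise [z] is past both births and before both deaths, hence in both triangles. *)
  have /orP[h|h] : (z.1 <= Num.max b b') || (Num.min d d' <= z.2).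
  - rewrite le_max ge_min; apply: contraR neqz.
    rewrite !negb_or -!ltNge => /andP[/andP[hb hb'] /andP[hd hd']].
    by rewrite (ltW hb) (ltW hb') hd hd'.
  - by left; rewrite bz zd h (le_trans bz z12).
  - by right; rewrite bz zd h (le_trans z12 zd).
apply: (@le_trans _ _ (mu B1 + mu B2)%E); first exact: measureU2.
rewrite [mu B1]lebesgue_rectangle // [mu B2]lebesgue_rectangle // -EFinD lee_fin.
have -> : Num.max b b' - lo = `|b - b'|.
  by rewrite /lo; case: (leP b b') => h;
    [rewrite ler0_norm ?subr_le0 // opprB|rewrite ger0_norm // subr_ge0 ltW].
have -> : hi - Num.min d d' = `|d - d'|.
  by rewrite /hi; case: (leP d d') => h;
    [rewrite ler0_norm ?subr_le0 // opprB|rewrite ger0_norm // subr_ge0 ltW].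
(* The strips have total area [c * (hi - lo)], which leaves [hi - lo <= d - b + c]. *)
rewrite [X in _ + X]mulrC -mulrDl ler_wpM2l ?addr_ge0 //.
have := ler_norm (b - b'); have := ler_norm (d' - d); rewrite distrC.
have := normr_ge0 (b - b'); have := normr_ge0 (d - d').
by rewrite /c /hi /lo; case: (leP b b') => _; case: (leP d d') => _ ; lra.
Qed.

(** The difference takes values in {-1, 0, 1}, so the p-th power of its absolute value is the
    indicator of the symmetric difference, whatever p is. *)
Lemma Lnorm_triB I J p : 1 <= p ->
  ('N[mu]_p%:E[EFin \o (tri I \- tri J)%R] =
   mu [set z | in_tri I z != in_tri J z] `^ p^-1)%E.
Proof.
move=> p1; have p0 : p != 0 by rewrite gt_eqF // (lt_le_trans ltr01).
rewrite unlock; congr (_ `^ _)%E.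
under eq_integral => z _.
  rewrite (_ : (_ `^ _)%E = (\1_[set z | in_tri I z != in_tri J z] z)%:E).
    over.
  rewrite indicE mem_setE -topredE /= /tri.
  case: in_tri; case: in_tri => /=;
    by rewrite ?subrr ?subr0 ?sub0r ?normrN ?normr1 ?normr0 ?powR1 ?powR0.
rewrite integral_indic ?setIT //; exact: measurable_tri_symdiff.
Qed.

(** An infinite death would be at distance [+oo] from [d]. When the deaths agree, the 0 of the test
    in [dist1] is also [|d - d'|]. *)
Lemma dist1_fin (u v : R * \bar R) d : u.2 = d%:E -> (dist1 u v < +oo)%E ->
  exists2 d', v.2 = d'%:E & dist1 u v = (`|u.1 - v.1| + `|d - d'|)%:E.
Proof.
case: u v => b _ [b' [d'||]] /= ->; rewrite /dist1 //=; exists d' => //.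
case: ifPn => [/eqP[->]|_]; last by [].
by rewrite subrr normr0 -EFinD.
Qed.

Lemma Lnorm_triB_le b d v c p : 1 <= p -> b <= d ->
  dist1 (b, d%:E) v = c%:E ->
  ('N[mu]_p%:E[EFin \o (tri (b, d%:E) \- tri v)%R] <=
    ((c * (d - b + c)) `^ p^-1)%:E)%E.
Proof.
move=> p1 bd cE; rewrite Lnorm_triB // -poweR_EFin.
have [|d' vE] := @dist1_fin (b, d%:E) v d erefl; first by rewrite cE ltry.
rewrite cE => -[->]; have := @area_tri_symdiff b d v.1 d' bd.
rewrite -vE -surjective_pairing => area.
have p0 : 0 <= p^-1 by rewrite invr_ge0 (le_trans ler01).
have c'0 : 0 <= `|b - v.1| + `|d - d'| by exact: addr_ge0.
apply: (gt0_ler_poweR p0) => //; rewrite in_itv /= leey andbT //.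
by rewrite lee_fin mulr_ge0 // addr_ge0 // subr_ge0.
Qed.
End Triangles.

(** * From the cost of a matching to the L^p norm *)

Lemma dist1_ge0 (R : realType) (u v : R * \bar R) : (0 <= dist1 u v)%E.
Proof. by rewrite /dist1 adde_ge0 //; case: ifP. Qed.

(** The first bound makes the contribution of a diagonal point linear in its cost, hence summable;
    the second turns the total cost back into a power 1/p. The range reaches 2 because matchings
    that approach an infimum of 1 may cost more than 1. *)
Lemma powR_inv12_le (R : realType) (p : nat) (c : R) : p = 1%N \/ p = 2%N ->
  0 <= c <= 2 ->
  (c * c) `^ p%:R^-1 <= 2 * c /\ c <= 2 * c `^ p%:R^-1.
Proof.
move=> hp /andP[c0 c2]; case: hp => ->.
  by rewrite invr1 !powRr1 ?mulr_ge0 //; nra.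
rewrite !powR12_sqrt ?mulr_ge0 // -expr2 sqrtr_sqr ger0_norm //.
split; first lra.
have : Num.sqrt c ^+ 2 = c by rewrite sqr_sqrtr.
have := sqrtr_ge0 c; set s := Num.sqrt c => s0 sc; rewrite -sc in c2 *; nra.
Qed.

Section Diagrams.
Local Open Scope classical_set_scope.
Variable R : realType.
Implicit Types bs : seq (R * \bar R).

Let mu := (@lebesgue_measure R \x @lebesgue_measure R)%E.

(** Indices sent to the diagonal contribute 0, so any finite list whose image contains all bars
    gives the full sum. Taking [psi] to be the identity and then the matching writes both rank
    functions as sums over one list. *)
Lemma sum_tri_cover bs bs'
    (psi : dgm_index (dgm_of_bars bs') -> dgm_index (dgm_of_bars bs))
    (s : seq (dgm_index (dgm_of_bars bs'))) z :
  uniq s -> injective psi -> (forall i, inl i \in map psi s) ->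
  \sum_(k <- s) tri (dgm_point (psi k)) z = \sum_(I <- bs) tri I z.
Proof.
move=> us inj_psi cov.
rewrite -(big_map psi predT (fun k => tri (dgm_point k) z)).
rewrite big_sum_type_inl ?map_inj_uniq //; last first.
  by case=> x n; rewrite tri_diag.
by rewrite [RHS]big_tnth.
Qed.

Lemma Lnorm_sum_triB_le bs bs' (p : nat) (c : R)
    (phi : dgm_index (dgm_of_bars bs) -> dgm_index (dgm_of_bars bs')) :
  p = 1%N \/ p = 2%N ->
  all (fun I => (I.1%:E < I.2)%E) bs -> (forall I, I \in bs -> (I.2 < +oo)%E) ->
  bijective phi -> c <= 2 ->
  \esum_(k in setT) dist1 (dgm_point k) (dgm_point (phi k)) = c%:E ->
  ('N[mu]_(p%:R)%:E[EFin \o (fun z => (\sum_(I <- bs) tri I z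
      - \sum_(I <- bs') tri I z)%R)]
    <= (((\sum_(I <- bs) (fine I.2 - I.1 + 2) `^ p%:R^-1 + 4)
         * c `^ p%:R^-1)%R)%:E)%E.
Proof.
move=> hp bsP bs_fin [psi phiK psiK] c2 cE.
have p1 : 1 <= p%:R :> R by rewrite ler1n; case: hp => ->.
have pV0 : 0 <= p%:R^-1 :> R by rewrite invr_ge0 (le_trans ler01).
(* The finitely many indices that are a bar or are matched with one. *)
pose k_inl (i : 'I_(size bs)) : dgm_index (dgm_of_bars bs) := inl i.
pose k_inv (j : 'I_(size bs')) := psi (inl j).
pose s :=
  undup (map k_inl (enum 'I_(size bs)) ++ map k_inv (enum 'I_(size bs'))).
have us : uniq s by exact: undup_uniq.
pose f k := (tri (dgm_point k) \- tri (dgm_point (phi k))) : R * R -> R.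
rewrite (_ : (fun z => _) = (fun z => \sum_(k <- s) f k z)); last first.
  apply/funext => z; rewrite /f sumrB; congr (_ - _); apply/esym.
    apply: (@sum_tri_cover bs bs id) => // i; rewrite map_id mem_undup mem_cat.
    by rewrite map_f ?mem_enum.
  apply: sum_tri_cover => //; first exact: can_inj phiK.
  move=> i; apply/mapP; exists (psi (inl i)); last by rewrite psiK.
  by rewrite mem_undup mem_cat orbC map_f ?mem_enum.
apply: (le_trans (Lnorm_sum_le _ _ _ _ _ _ _ _ p1 _)).
  by move=> k; apply: measurable_funB; exact: measurable_tri.
pose cost k := fine (dist1 (dgm_point k) (dgm_point (phi k))).
(* Finite partial sums of nonnegative costs stay below the total; hence every cost is finite, so
   that [fine] loses nothing, and is at most [c]. *)
have le_c (t : seq (dgm_index (dgm_of_bars bs))) : uniq t ->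
    (\sum_(k <- t) dist1 (dgm_point k) (dgm_point (phi k)) <= c%:E)%E.
  move=> ut; rewrite -cE; apply: esum_ge; exists [set` t].
    by split => //; exact: finite_seq.
  by rewrite fsbig_seq.
have le_c1 k : (dist1 (dgm_point k) (dgm_point (phi k)) <= c%:E)%E.
  by have := le_c [:: k] isT; rewrite big_seq1.
have costE k : dist1 (dgm_point k) (dgm_point (phi k)) = (cost k)%:E.
  by rewrite fineK // ge0_fin_numE ?dist1_ge0 // (le_lt_trans (le_c1 k)) ?ltry.
have cost0 k : 0 <= cost k by rewrite fine_ge0 // dist1_ge0.
have cost_c k : cost k <= c by rewrite -lee_fin -costE.
have c0 : 0 <= c by rewrite -lee_fin -cE esum_ge0 // => k _; exact: dist1_ge0.
(* A bar of length l and cost c' is charged [h], since [c' * (l + c') <= (l + 2) * c] when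
   [c' <= c <= 2]. A diagonal point has l = 0 and is charged twice its cost. Giving both charges to
   every index lets the sum split in two. *)
pose h (k : dgm_index (dgm_of_bars bs)) : R := match k with
  | inl i => let I := tnth (in_tuple bs) i in
             ((fine I.2 - I.1 + 2) * c) `^ p%:R^-1
  | inr _ => 0
  end.
apply: (@le_trans _ _ (\sum_(k <- s) (h k + 2 * cost k)%:E)%E).
  apply: lee_sum => k _; rewrite /f /h.
  move: (costE k) (cost0 k) (cost_c k); move: (cost k) => c'.
  case: k => [i|[x n]] /= kE c'0 c'c.
    have Ibs := mem_tnth i (in_tuple bs).
    move: (allP bsP _ Ibs) (bs_fin _ Ibs) kE.
    case: (tnth _ i) => b [d||] //=; rewrite lte_fin => bd _ kE.
    apply: (le_trans (Lnorm_triB_le _ _ _ _ _ _ p1 (ltW bd) kE)).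
    rewrite lee_fin; apply: (@le_trans _ _ (((d - b + 2) * c) `^ p%:R^-1));
      last by rewrite lerDl mulr_ge0.
    have bd0 : 0 <= d - b by rewrite subr_ge0 ltW.
    apply: ge0_ler_powR => //; rewrite ?nnegrE.
    - by rewrite mulr_ge0 // addr_ge0.
    - by rewrite mulr_ge0 // addr_ge0.
    rewrite mulrC; apply: ler_pM => //; first exact: addr_ge0.
    by rewrite lerD2l (le_trans c'c).
  apply: (le_trans (Lnorm_triB_le _ _ _ _ _ _ p1 (lexx x) kE)).
  rewrite lee_fin subrr !add0r; apply: (powR_inv12_le _ _ _ hp _).1.
  by rewrite c'0 (le_trans c'c).
rewrite sumEFin lee_fin big_split /= mulrDl; apply: lerD.
  rewrite big_sum_type_inl //; last first.
    by move=> i; rewrite mem_undup mem_cat map_f ?mem_enum.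
  rewrite mulr_suml [leRHS]big_tnth ler_sum // => i _ /=.
  have Ibs := mem_tnth i (in_tuple bs).
  rewrite powRM //; move: (allP bsP _ Ibs) (bs_fin _ Ibs).
  case: (tnth _ i) => b [d||] //=; rewrite lte_fin => bd _.
  by rewrite addr_ge0 // subr_ge0 ltW.
(* One factor 2 comes from the charge [2 * cost k], the other from the bound of [c] by twice its
   power 1/p. *)
rewrite -mulr_sumr (_ : 4 = 2 * 2 :> R) -?mulrA ?ler_pM2l //; last first.
  by rewrite -natrM.
apply: (@le_trans _ _ c).
  by have := le_c s us; under eq_bigr do rewrite costE; rewrite sumEFin lee_fin.
by apply: (powR_inv12_le _ _ _ hp _).2; rewrite c0.
Qed.
End Diagrams.

(** * Passing to the infimum over matchings *)

Lemma le_powR_inv (R : realType) (p : nat) (x y : R) : (0 < p)%N -> 0 <= x ->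
  0 <= y -> (x <= y `^ p%:R^-1) = (x ^+ p <= y).
Proof.
move=> p0 x0 y0; rewrite -(ler_pXn2r p0) ?nnegrE ?powR_ge0 //.
rewrite -[(y `^ _) ^+ p]powR_mulrn ?powR_ge0 // -powRrM.
by rewrite mulVf ?pnatr_eq0 ?gtn_eqF // powRr1.
Qed.

(** All triangles lie in [R2plus], so restricting the integrand to it changes nothing. *)
Lemma normp_rankB (R : realType) (F : fieldType) (M N : pmodule R F) (p : R) :
  interval_decomposable M -> interval_decomposable N ->
  normp p (fun z => (rank_fun M z - rank_fun N z)%:~R) =
  ('N[(@lebesgue_measure R \x @lebesgue_measure R)]_p%:E[EFin \o
     (fun z => (\sum_(I <- barcode M) tri I z
       - \sum_(I <- barcode N) tri I z)%R)])%E.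
Proof.
move=> hM hN; apply: eq_Lnorm => z.
rewrite patchE mem_setE /R2plus /= -topredE /=.
rewrite rmorphB /= !rank_fun_barcode // !rmorph_sum /=.
have tri0 (bs : seq (R * \bar R)) : (z.1 <= z.2) = false ->
    \sum_(I <- bs) tri I z = 0.
  by move=> nz; rewrite big1 // => I _; rewrite /tri /in_tri nz andbF.
by case: ifPn => // /negbTE nz; rewrite !tri0 ?subrr.
Qed.

Theorem theorem12 (R : realType) (F : fieldType) (p : nat)
    (hp : p = 1%N \/ p = 2%N)
    (M : pmodule R F) (hM : interval_decomposable M)
    (hfin : forall I, I \in barcode M -> (I.2 < +oo)%E) :
  exists C : R, 0 < C /\
    forall N : pmodule R F, interval_decomposable N ->
      (W1 (Dgm M) (Dgm N) <= 1)%E ->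
      (normp p%:R (fun z => (rank_fun M z - rank_fun N z)%:~R)
         <= C%:E * (W1 (Dgm M) (Dgm N)) `^ (p%:R)^-1)%E.
Proof.
have p0 : (0 < p)%N by case: hp => ->.
pose C : R := \sum_(I <- barcode M) (fine I.2 - I.1 + 2) `^ p%:R^-1 + 4.
have C0 : 0 < C by rewrite ltr_wpDl // sumr_ge0 // => I _; exact: powR_ge0.
exists C; split => // N hN W1_le1; rewrite normp_rankB //.
set n := ('N[_]_ _[_])%E; have n0 : (0 <= n)%E by exact: Lnorm_ge0.
pose costs := [set e | exists phi : dgm_index (Dgm M) -> dgm_index (Dgm N),
  bijective phi /\
  e = \esum_(i in setT) dist1 (dgm_point i) (dgm_point (phi i))]%classic.
have costs_ge0 e : costs e -> (0 <= e)%E.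
  by move=> [phi [_ ->]]; apply: esum_ge0 => i _; exact: dist1_ge0.
have n_le c : c <= 2 -> costs c%:E -> (n <= (C * c `^ p%:R^-1)%:E)%E.
  move=> c2 [phi [phi_bij cE]].
  exact: (Lnorm_sum_triB_le _ _ _ _ _ phi hp (barcodeP _ _ _ hM).1 hfin).
(* The infimum need not be attained, but some matching costs less than 2. It shows that the norm [n]
   is finite and later serves as a comparison for matchings of cost above 2. *)
have [e0 e0P e02] : exists2 e, costs e & (e < 2%:E)%E.
  by apply: ereal_inf_lt; apply: le_lt_trans W1_le1 _; rewrite lte_fin ltr1n.
have := costs_ge0 _ e0P.
case: e0 e0P e02 => [c0||] // c0P; rewrite lte_fin lee_fin => c02 c0_ge0.
have : (n <= (C * c0 `^ p%:R^-1)%:E)%E by apply: n_le => //; exact: ltW.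
case: n n0 n_le => [r||] // r0 n_le _; rewrite lee_fin in r0.
(* Solving the bound for [c] replaces a limit argument: [(r / C) ^+ p] is a lower bound of all
   costs, hence of their infimum. *)
have rC c : 0 <= c -> (r%:E <= (C * c `^ p%:R^-1)%:E)%E = ((r / C) ^+ p <= c).
  move=> c_ge0; rewrite lee_fin -ler_pdivrMl // mulrC.
  by rewrite le_powR_inv // divr_ge0 // ltW.
have : (((r / C) ^+ p)%:E <= W1 (Dgm M) (Dgm N))%E.
  apply: le_ereal_inf_tmp => e eP; have := costs_ge0 _ eP.
  case: e eP => [c||] // cP; rewrite ?leey // !lee_fin => c_ge0.
  have [c2|/ltW c2] := leP c 2; first by rewrite -rC // n_le.
  apply: (le_trans _ c2); apply: (le_trans _ (ltW c02)).
  by rewrite -rC // n_le // ltW.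
case: (W1 _ _) W1_le1 => [w||] //= _; rewrite ?lee_fin => rw.
have w0 : 0 <= w by apply: le_trans rw; rewrite exprn_ge0 // divr_ge0 // ltW.
by rewrite -lee_fin rC.
Qed.
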